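(* Let $X$ be a smooth complex threefold and let $u$ be a holomorphic Poisson structure on $X$, i.e. an integrable holomorphic bivector field $u \in H^0(X,\Lambda^2 TX)$. Then for every holomorphic function $f\in\mathcal O(X)$ the bivector field $fu$ is integrable.
   Context: A holomorphic bivector field $q\in H^0(X,\Lambda^2TX)$ is called integrable (equivalently, a Poisson bivector, or Poisson structure) if its Schouten–Nijenhuis self-bracket vanishes: $[q,q]=0$. $\mathcal O(X)$ denotes the ring of global holomorphic functions on $X$. *)

(* Defs.v *)
From mathcomp Require Import all_boot all_order all_algebra.
From mathcomp Require Import complex.
From mathcomp Require Import boolp classical_sets functions cardinality reals.
From mathcomp Require Import topology normedtype derive.

Set Implicit Arguments.
Unset Strict Implicit.
Unset Printing Implicit Defensive.

Import Order.TTheory GRing.Theory Num.Theory.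
Import numFieldNormedType.Exports.

Local Open Scope classical_set_scope.
Local Open Scope ring_scope.

(* Presenting R[i] as the sort of a numFieldType makes the norm topology of
   that structure, and the sup norm on matrices over it, inferable. *)
Definition Cplx (R : realType) : numFieldType := R[i].

(* To be used on open U only, where complex Frechet differentiability at every
   point is holomorphy. *)
Definition holomorphic_on (R : realType) (n : nat)
    (W : normedModType (Cplx R)) (U : set 'rV[Cplx R]_n)
    (g : 'rV[Cplx R]_n -> W) : Prop :=
  forall z, U z -> differentiable g z.

(* chart_inv i is only meaningful on the (open) image of chart i. *)
Record complex_manifold (R : realType) (n : nat) := ComplexManifold {
  carrier :> topologicalType;
  carrier_hausdorff : hausdorff_space carrier;
  carrier_second_countable : @second_countable carrier;
  chart_index : Type;
  chart_dom : chart_index -> set carrier;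
  chart : chart_index -> carrier -> 'rV[Cplx R]_n;
  chart_inv : chart_index -> 'rV[Cplx R]_n -> carrier;
  chart_dom_open : forall i, open (chart_dom i);
  chart_dom_cover : forall x, exists i, chart_dom i x;
  chart_image_open : forall i, open (chart i @` chart_dom i);
  chartK : forall i x, chart_dom i x -> chart_inv i (chart i x) = x;
  chart_continuous : forall i, {within chart_dom i, continuous (chart i)};
  chart_inv_continuous :
    forall i, {within chart i @` chart_dom i, continuous (chart_inv i)};
  transition_holomorphic : forall i j,
    holomorphic_on (chart i @` (chart_dom i `&` chart_dom j))
      (chart j \o chart_inv i)
}.

Arguments chart_index {R n} X : rename.
Arguments chart_dom {R n} X i : rename.
Arguments chart {R n} X i x : rename.
Arguments chart_inv {R n} X i z : rename.

Definition chart_image (R : realType) (n : nat) (X : complex_manifold R n)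
    (i : chart_index X) : set 'rV[Cplx R]_n :=
  chart X i @` chart_dom X i.

Record holomorphic_function (R : realType) (n : nat)
    (X : complex_manifold R n) := HolomorphicFunction {
  hol_fun :> X -> Cplx R;
  hol_fun_holomorphic :
    forall i, holomorphic_on (chart_image i) (hol_fun \o chart_inv X i)
}.

(* A section of Lambda^2 TX, given by its components in each chart: at the point
   z of the i-th chart image, with M = bivector_coef i z, it is the bivector
   \sum_(a < b) M a b d_a /\ d_b.  As jacobian acts on row vectors by right
   multiplication, a tangent vector v becomes v *m J after a change of chart,
   whence the law for M.  Values off the chart images are irrelevant. *)
Record bivector_field (R : realType) (n : nat) (X : complex_manifold R n) :=
  BivectorField {
  bivector_coef :> chart_index X -> 'rV[Cplx R]_n -> 'M[Cplx R]_n;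
  bivector_antisym : forall i z, chart_image i z ->
    (bivector_coef i z)^T = - bivector_coef i z;
  bivector_holomorphic : forall i a b,
    holomorphic_on (chart_image i)
      (fun z => bivector_coef i z a b : (Cplx R)^o);
  bivector_transition : forall i j x, chart_dom X i x -> chart_dom X j x ->
    let J := jacobian (chart X j \o chart_inv X i) (chart X i x) in
    bivector_coef j (chart X j x) =
      J^T *m bivector_coef i (chart X i x) *m J
}.

Section ScaleBivector.
Variables (R : realType) (n : nat) (X : complex_manifold R n).
Variables (f : holomorphic_function X) (q : bivector_field X).

Let coef (i : chart_index X) (z : 'rV[Cplx R]_n) : 'M[Cplx R]_n :=
  f (chart_inv X i z) *: q i z.

Lemma scale_bivector_antisym i z : chart_image i z ->
  (coef i z)^T = - coef i z.
Proof. by move=> iz; rewrite /coef linearZ /= bivector_antisym // scalerN. Qed.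

Lemma scale_bivector_holomorphic i a b :
  holomorphic_on (chart_image i) (fun z => coef i z a b : (Cplx R)^o).
Proof.
move=> z iz.
rewrite (_ : (fun _ => _) =
  (f \o chart_inv X i) * (fun w => q i w a b : (Cplx R)^o)).
  by apply: differentiableM;
    [exact: hol_fun_holomorphic | exact: bivector_holomorphic].
by apply/funext => w; rewrite /coef !mxE.
Qed.

Lemma scale_bivector_transition i j x :
  chart_dom X i x -> chart_dom X j x ->
  let J := jacobian (chart X j \o chart_inv X i) (chart X i x) in
  coef j (chart X j x) = J^T *m coef i (chart X i x) *m J.
Proof.
move=> ix jx /=; rewrite /coef !chartK // (bivector_transition q ix jx).
by rewrite -scalemxAr -scalemxAl.
Qed.

Definition scale_bivector : bivector_field X :=
  BivectorField scale_bivector_antisym scale_bivector_holomorphic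
    scale_bivector_transition.

End ScaleBivector.

Section Schouten.
Variables (K : numFieldType) (n : nat).
Local Notation vector := 'rV[K]_n.
Local Notation trivector := {ffun 'I_n * 'I_n * 'I_n -> K}.

Definition wedge3 (a b c : vector) : trivector :=
  [ffun t : 'I_n * 'I_n * 'I_n => \det (\matrix_(r < 3, s < 3)
    tnth [tuple a; b; c] r 0 (tnth [tuple t.1.1; t.1.2; t.2] s))].

Definition lie_bracket (v w : vector -> vector) (z : vector) : vector :=
  'D_(v z) w z - 'D_(w z) v z.

(* [v1 /\ v2, w1 /\ w2] =
     \sum_(i, j) (-1)^(i + j) [vi, wj] /\ v(3 - i) /\ w(3 - j) *)
Definition schouten_decomposable (v1 v2 w1 w2 : vector -> vector)
    (z : vector) : trivector :=
  wedge3 (lie_bracket v1 w1 z) (v2 z) (w2 z)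
  - wedge3 (lie_bracket v1 w2 z) (v2 z) (w1 z)
  - wedge3 (lie_bracket v2 w1 z) (v1 z) (w2 z)
  + wedge3 (lie_bracket v2 w2 z) (v1 z) (w1 z).

Definition coord_field (a : 'I_n) : vector -> vector :=
  fun=> delta_mx 0 a.

(* The biadditive extension of the previous formula, applied to the
   decompositions p = \sum_(a < b) (p a b d_a) /\ d_b and likewise for q. *)
Definition schouten (p q : vector -> 'M[K]_n) (z : vector) : trivector :=
  \sum_(a < n) \sum_(b < n | (a < b)%N) \sum_(c < n) \sum_(d < n | (c < d)%N)
    schouten_decomposable
      (fun y => p y a b *: coord_field a y) (coord_field b)
      (fun y => q y c d *: coord_field c y) (coord_field d) z.

End Schouten.

Definition integrable_bivector (R : realType) (n : nat) (X : complex_manifold R n)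
    (q : bivector_field X) : Prop :=
  forall i z, chart_image i z -> schouten (q i) (q i) z = 0.

(* Main.v *)
Require Import Defs.
From mathcomp Require Import all_boot all_order all_algebra.
From mathcomp Require Import reals.
From mathcomp Require Import boolp functions.
From mathcomp Require Import topology normedtype derive.
From mathcomp Require Import ring.

(** Integrability is tested chart by chart and point by point, so the question
is about the local Schouten bracket of f p and f q, where p and q are bivector
fields on an open part of K^n.  The bracket obeys the Leibniz rule
   [f p, f q] = f^2 [p, q] + f * i_df (p /\ q)   (up to sign),
the correction being the contraction of the 4-vector p /\ q by the differential
of f.  In dimension n < 4 there are no nonzero 4-vectors, so [f p, f q] is just
f^2 [p, q] ([schouten_scale]), and this vanishes as soon as [p, q] does.

The bracket is a sum over decomposable terms, and the argument works for each
term separately.  [schouten_decomposableE] computes the bracket of g x /\ y and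
h v /\ w for constant vectors x, y, v, w; replacing g and h by f g and f h there
makes the correction appear as - f g h times the contraction of x /\ y /\ v /\ w
by df, which [contraction_wedge4_eq0] shows to be zero.  That lemma reads the
contraction as the expansion along its first column of a 4 x 4 determinant
whose matrix factors through K^n. *)

Set Implicit Arguments.
Unset Strict Implicit.
Unset Printing Implicit Defensive.

Import GRing.Theory.
Import numFieldNormedType.Exports.

Local Open Scope ring_scope.

Lemma det_mulmx_thin (K : fieldType) (m n : nat) (A : 'M[K]_(m, n))
  (B : 'M[K]_(n, m)) : (n < m)%N -> \det (A *m B) = 0.
Proof.
move=> ltnm; apply/eqP; apply: contraTT ltnm => nz_det.
have : A *m B \in unitmx by rewrite unitmxE unitfE.
by move/mxrank_unit => rkAB; rewrite -leqNgt -{1}rkAB mulmx_max_rank.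
Qed.

Section Wedge3.
Variables (K : numFieldType) (n : nat).
Implicit Types a b c : 'rV[K]_n.

Lemma wedge3E a b c t :
  let x0 := a 0 t.1.1 in let x1 := a 0 t.1.2 in let x2 := a 0 t.2 in
  let y0 := b 0 t.1.1 in let y1 := b 0 t.1.2 in let y2 := b 0 t.2 in
  let z0 := c 0 t.1.1 in let z1 := c 0 t.1.2 in let z2 := c 0 t.2 in
  wedge3 a b c t = x0 * (y1 * z2 - y2 * z1) - x1 * (y0 * z2 - y2 * z0)
                   + x2 * (y0 * z1 - y1 * z0).
Proof.
rewrite /= ffunE (expand_det_row _ ord0) !big_ord_recl big_ord0 /cofactor.
rewrite !(expand_det_row _ ord0) !big_ord_recl !big_ord0 /cofactor !det_mx11.
rewrite !mxE /= !(tnth_nth 0) /= !(tnth_nth t.2) /=.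
ring.
Qed.

Lemma wedge3C a b c t : wedge3 a b c t = - wedge3 b a c t.
Proof. by rewrite !wedge3E; ring. Qed.

End Wedge3.

(** The left-hand side is the contraction of a /\ b /\ c /\ d by l.  Its
t-component is the determinant of the 4 x 4 matrix whose row for a vector x is
(l x, x_t1, x_t2, x_t3), expanded along the first column.  All four entries of
such a row are linear forms in x, so the matrix is the product of the 4 x n
matrix of the vectors and the n x 4 matrix of the forms, of rank at most n. *)
Lemma contraction_wedge4_eq0 (K : numFieldType) (n : nat) (a b c d : 'rV[K]_n)
    (l : {linear 'rV[K]_n -> K^o}) (t : 'I_n * 'I_n * 'I_n) : (n < 4)%N ->
  l a * wedge3 b c d t - l b * wedge3 a c d t
  + l c * wedge3 a b d t - l d * wedge3 a b c t = 0.
Proof.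
move=> lt_n4.
pose A := \matrix_(r < 4) tnth [tuple a; b; c; d] r.
pose B := \matrix_(k < n, s < 4)
  tnth [tuple (l (delta_mx 0 k) : K); (k == t.1.1)%:R; (k == t.1.2)%:R;
              (k == t.2)%:R] s.
have lE (x : 'rV[K]_n) : \sum_k x 0 k * (l (delta_mx 0 k) : K) = l x.
  by rewrite [in RHS](row_sum_delta x) linear_sum; apply: eq_bigr => k _;
     rewrite linearZ.
have coordE (x : 'rV[K]_n) j : \sum_k x 0 k * (k == j)%:R = x 0 j.
  rewrite (bigD1 j) //= eqxx mulr1 big1 ?addr0 // => k /negPf ->.
  by rewrite mulr0.
pose M := \matrix_(r < 4, s < 4) (fun x : 'rV[K]_n =>
  tnth [tuple (l x : K); x 0 t.1.1; x 0 t.1.2; x 0 t.2] s)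
  (tnth [tuple a; b; c; d] r).
have M_factor : M = A *m B.
  apply/matrixP => r s; rewrite !mxE; set x := tnth _ r.
  under eq_bigr do rewrite !mxE -/x.
  case: s => [[|[|[|[|//]]]] ?] /=; rewrite (tnth_nth 0) /= -?lE -?coordE;
  by apply: eq_bigr => k _; rewrite (tnth_nth 0).
have minorE (r : 'I_4) x y z :
    (forall p, tnth [tuple a; b; c; d] (lift r p) = tnth [tuple x; y; z] p) ->
  cofactor M r ord0 = (-1) ^+ r * wedge3 x y z t.
  move=> rowE; rewrite /cofactor addn0 ffunE; congr (_ * \det _).
  apply/matrixP => p q; rewrite !mxE rowE.
  by case: q => [[|[|[|//]]] ?]; rewrite !(tnth_nth 0).
have <- : \det M = 0 by rewrite M_factor det_mulmx_thin.
rewrite (expand_det_col _ ord0) !big_ord_recl big_ord0.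
rewrite (minorE _ b c d) 1?(minorE _ a c d) 1?(minorE _ a b d)
  1?(minorE _ a b c);
  try by case=> [[|[|[|//]]] ?]; rewrite !(tnth_nth 0).
rewrite !mxE !(tnth_nth 0) /=; ring.
Qed.

Section Leibniz.
Variables (K : numFieldType) (n : nat).
Implicit Types (x y v w z : 'rV[K]_n) (f g h : 'rV[K]_n -> K^o).

Lemma derive_scale_cst h x v z dh : is_diff z h dh ->
  'D_v (fun p => h p *: x) z = dh v *: x.
Proof.
case=> diff_h <-.
by rewrite deriveE ?diffZl //; exact: differentiableZl.
Qed.

(** As the vectors x, y, v, w are constant, only the derivatives of g and h enter
the Lie brackets; the bracket of g x and h v contributes two terms, those of g x
with w and of y with h v one term each, and that of y with w vanishes. *)
Lemma schouten_decomposableE g h x y v w z t dg dh :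
  is_diff z g dg -> is_diff z h dh ->
  schouten_decomposable (fun p => g p *: x) (fun=> y)
    (fun p => h p *: v) (fun=> w) z t
  = g z * dh x * wedge3 v y w t - h z * dg v * wedge3 x y w t
    + h z * dg w * wedge3 x y v t - g z * dh y * wedge3 v x w t.
Proof.
move=> diff_g diff_h; rewrite /schouten_decomposable /lie_bracket.
rewrite !(derive_scale_cst _ _ diff_g) !(derive_scale_cst _ _ diff_h).
have dgZ k u : dg (k *: u) = k * dg u.
  by case: diff_g => _ <-; rewrite linearZ.
have dhZ k u : dh (k *: u) = k * dh u.
  by case: diff_h => _ <-; rewrite linearZ.
rewrite ![fun=> _]/(cst _) !derive_cst !dgZ !dhZ.
have ffunD (F G : {ffun 'I_n * 'I_n * 'I_n -> K}) : (F + G) t = F t + G t.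
  by rewrite ffunE.
have ffunN (F : {ffun 'I_n * 'I_n * 'I_n -> K}) : (- F) t = - F t.
  by rewrite ffunE.
by rewrite !(ffunD, ffunN) !wedge3E !mxE; ring.
Qed.

(** After the product rule, the terms in which f is not differentiated give
f^2 times the bracket of g x /\ y and h v /\ w, and those in which f is
differentiated give - f g h times the contraction of x /\ y /\ v /\ w by df. *)
Lemma schouten_decomposable_scale f g h x y v w z t df dg dh : (n < 4)%N ->
  is_diff z f df -> is_diff z g dg -> is_diff z h dh ->
  schouten_decomposable (fun p => (f p * g p) *: x) (fun=> y)
    (fun p => (f p * h p) *: v) (fun=> w) z t
  = f z ^+ 2 * schouten_decomposable (fun p => g p *: x) (fun=> y)
    (fun p => h p *: v) (fun=> w) z t.
Proof.
move=> lt_n4 diff_f diff_g diff_h.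
have diff_fM k dk : is_diff z k dk ->
    is_diff z (fun p => f p * k p) (fun u => f z * dk u + k z * df u).
  exact: is_diffM.
rewrite (schouten_decomposableE x y v w t diff_g diff_h).
rewrite (schouten_decomposableE x y v w t (diff_fM g dg diff_g)
  (diff_fM h dh diff_h)).
have [_ df_val] := diff_f.
have := contraction_wedge4_eq0 x y v w ('d f z) t lt_n4; rewrite df_val.
(* The contraction identity lists its factors in the order x, y, v, w. *)
rewrite (wedge3C v y) (wedge3C v x).
(* As variables, the wedge products are not unfolded when compared by [ring]. *)
move: (wedge3 y v w t) (wedge3 x v w t) (wedge3 x y w t) (wedge3 x y v t).
move=> yvw xvw xyw xyv contr0; apply/eqP; rewrite -subr_eq0; apply/eqP.
transitivity (- (f z * g z * h z) * (0 : K)); last by rewrite mulr0.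
by rewrite -contr0; ring.
Qed.

Lemma schouten_scale f (p q : 'rV[K]_n -> 'M[K]_n) z t : (n < 4)%N ->
  differentiable f z ->
  (forall a b, differentiable (fun y => p y a b : K^o) z) ->
  (forall a b, differentiable (fun y => q y a b : K^o) z) ->
  schouten (fun y => f y *: p y) (fun y => f y *: q y) z t
  = f z ^+ 2 * schouten p q z t.
Proof.
move=> lt_n4 df dp dq; have entryE (r : 'rV[K]_n -> 'M[K]_n) a b :
    (fun y => (f y *: r y) a b *: coord_field a y)
    = (fun y => (f y * r y a b) *: delta_mx 0 a).
  by apply/funext => y; rewrite mxE.
rewrite /schouten.
do 4 (rewrite [LHS]sum_ffunE [X in _ * X]sum_ffunE mulr_sumr;
      apply: eq_bigr => ? _).
rewrite !entryE.
exact: (schouten_decomposable_scale _ _ _ _ _ lt_n4 (differentiableP df)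
  (differentiableP (dp _ _)) (differentiableP (dq _ _))).
Qed.

End Leibniz.

Theorem proposition1p2 (R : realType) (X : complex_manifold R 3)
    (u : bivector_field X) (hu : integrable_bivector u)
    (f : holomorphic_function X) :
  integrable_bivector (scale_bivector f u).
Proof.
move=> i z iz; apply/ffunP => t.
have df := hol_fun_holomorphic f iz.
have du a b := bivector_holomorphic u a b iz.
have := schouten_scale t (isT : (3 < 4)%N) df du du.
by rewrite (hu i z iz) !ffunE mulr0.
Qed.
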